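(* Assume $\mathfrak{b}=\mathfrak{c}$. Let $\mathcal{B}$ and $\mathcal{C}$ be two barriers on $\omega$ such that $\mathsf{FIN}^{\mathcal{C}}\not\leq_K\mathcal{G}_c(\mathcal{B})$. Then there is a topological space that is $\mathcal{B}$-sequentially compact but not $\mathcal{C}$-sequentially compact.
   Context: $\mathfrak{b}$ is the bounding number (least size of a $\leq^*$-unbounded family in $\omega^\omega$) and $\mathfrak{c}=2^{\aleph_0}$. For sets of naturals, $s\sqsubseteq t$ means $s$ is an initial segment of $t$. For $\mathcal{F}\subseteq[\omega]^{<\omega}$ and $M\subseteq\omega$ let $\mathcal{F}|M=\{s\in\mathcal{F}:s\subseteq M\}$. A barrier on an infinite set $M\subseteq\omega$ is a family $\mathcal{B}$ of finite subsets of $M$ such that (a) $s\subseteq t$ implies $s=t$ for $s,t\in\mathcal{B}$, and (b) every infinite $N\subseteq M$ has an initial segment $s\sqsubseteq N$ with $s\in\mathcal{B}$. The family $\{\emptyset\}$ is regarded as a barrier. For $n\in M$ put $\mathcal{B}(n)=\{t\in\mathcal{B}:\min t=n\}$ and $\mathcal{B}[n]=\{t\setminus\{n\}:t\in\mathcal{B}(n)\}$, which is a barrier on $M\setminus(n+1)$ when $\mathcal B\neq\{\emptyset\}$. Sequential compactness: if $\mathcal{B}$ is a barrier on an infinite set $M$, $f:\mathcal{B}\to X$ converges to $x\in X$ if for every open $U\ni x$ there is $n\in\omega$ with $f[\mathcal{B}|(M\setminus n)]\subseteq U$. For a barrier $\mathcal{B}$ on $\omega$, a space $X$ is $\mathcal{B}$-sequentially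 compact if for every $f:\mathcal{B}\to X$ there is an infinite $M\subseteq\omega$ such that $f\restriction(\mathcal{B}|M)$ converges to some point of $X$. Ideals: $\mathsf{FIN}$ is the ideal of finite subsets of $\omega$. For a barrier $\mathcal{B}$, $\mathsf{FIN}^{\mathcal{B}}$ is the ideal on $\mathcal{B}$ defined recursively: $\mathsf{FIN}^{\{\emptyset\}}=\{\emptyset\}$ (only the empty subset of $\{\emptyset\}$), and otherwise $X\subseteq\mathcal{B}$ is in $\mathsf{FIN}^{\mathcal{B}}$ iff the set of $n$ such that $\{s\setminus\{n\}:s\in X\cap\mathcal{B}(n)\}\notin\mathsf{FIN}^{\mathcal{B}[n]}$ is finite. (In particular $\mathsf{FIN}^{[\omega]^1}$ is essentially $\mathsf{FIN}$.) $\mathcal{G}_c(\mathcal{B})$ is the ideal on $\mathcal{B}$ of all $S\subseteq\mathcal{B}$ for which there is no infinite $X\subseteq\omega$ with $\mathcal{B}|X\subseteq S$. Katětov order: for ideals $\mathcal{I}$ on $X$ and $\mathcal{J}$ on $Y$ ($X,Y$ countable), $\mathcal{I}\leq_K\mathcal{J}$ iff there is $f:Y\to X$ with $f^{-1}(A)\in\mathcal{J}$ for all $A\in\mathcal{I}$. *)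

(* Defs.v *)
From HB Require Import structures.
From mathcomp Require Import all_boot all_order finmap.
From mathcomp Require Import boolp classical_sets functions cardinality filter.
From mathcomp Require Import topology.

Set Implicit Arguments.
Unset Strict Implicit.
Unset Printing Implicit Defensive.

Local Open Scope classical_set_scope.
Local Open Scope card_scope.

Definition le_star (f g : nat -> nat) : Prop :=
  \forall n \near \oo, (f n <= g n)%N.

Definition unbounded (F : set (nat -> nat)) : Prop :=
  ~ exists g, forall f, F f -> le_star f g.

(* The least size of an unbounded family is that of the continuum. *)
Definition b_eq_c : Prop :=
  exists F : set (nat -> nat),
    [/\ unbounded F,
        forall G, unbounded G -> F #<= G
      & F #= [set: set nat]].

Definition initial_segment (s t : set nat) : Prop :=
  s `<=` t /\ forall i j, s i -> t j -> (j < i)%N -> s j.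

(* F|M *)
Definition restr (F : set {fset nat}) (M : set nat) : set {fset nat} :=
  [set s | F s /\ [set` s] `<=` M].

Definition barrier (M : set nat) (B : set {fset nat}) : Prop :=
  [/\ infinite_set M,
      forall s, B s -> [set` s] `<=` M,
      forall s t, B s -> B t -> [set` s] `<=` [set` t] -> s = t
    & forall N, infinite_set N -> N `<=` M ->
        exists2 s, B s & initial_segment [set` s] N].

(* F(n) *)
Definition with_min (F : set {fset nat}) (n : nat) : set {fset nat} :=
  [set t | [/\ F t, n \in t & forall m, m \in t -> (n <= m)%N]].

(* F[n] *)
Definition section (F : set {fset nat}) (n : nat) : set {fset nat} :=
  [set (t `\ n)%fset | t in with_min F n].

Definition above (M : set nat) (n : nat) : set nat :=
  [set m | M m /\ (n < m)%N].

(* The ideal FIN^B of a barrier B on M. On barriers, passing from B to B[n] is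
   well founded (ending at {emptyset}), so the recursion has a unique solution
   there and the inductive definition is that solution. The finite set E of
   exceptions keeps the occurrence of FIN strictly positive; [FIN_recE] is the
   form with the set of n for which membership fails. As X `<=` B, the section
   X[n] is that of X `&` B(n). *)
Inductive FIN : set nat -> set {fset nat} -> set {fset nat} -> Prop :=
| FIN_trivial M : FIN M [set fset0] set0
| FIN_rec M B X (E : set nat) :
    B <> [set fset0] -> X `<=` B -> finite_set E ->
    (forall n, M n -> ~ E n -> FIN (above M n) (section B n) (section X n)) ->
    FIN M B X.

Lemma FIN_trivialE M X : FIN M [set fset0] X <-> X = set0.
Proof.
split=> [H|->]; last exact: FIN_trivial.
by inversion H.
Qed.

Lemma FIN_recE M B X : B <> [set fset0] ->
  FIN M B X <->
  X `<=` B /\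
  finite_set
    [set n | M n /\ ~ FIN (above M n) (section B n) (section X n)].
Proof.
move=> B0; split=> [H|[XB fin]].
  case: H B0 => [? /(_ erefl)//|{}M {}B {}X E _ XB finE H _]; split=> //.
  apply: sub_finite_set finE => n [Mn nF]; apply: contrapT => En.
  by apply: nF; apply: H.
apply: FIN_rec B0 XB fin _ => n Mn; rewrite /= => nn.
by apply: contrapT => nF; apply: nn.
Qed.

Definition Gc (B : set {fset nat}) : set (set {fset nat}) :=
  [set S | S `<=` B /\ ~ exists2 X, infinite_set X & restr B X `<=` S].

(* I is an ideal on the set X and J an ideal on the set Y. *)
Definition katetov_le (T U : Type) (X : set T) (I : set (set T))
    (Y : set U) (J : set (set U)) : Prop :=
  exists2 f : U -> T, set_fun Y X f & forall A, I A -> J (Y `&` f @^-1` A).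

(* Only the values of f on B matter. *)
Definition barrier_cvg (X : topologicalType) (M : set nat)
    (B : set {fset nat}) (f : {fset nat} -> X) (x : X) : Prop :=
  forall U : set X, open U -> U x ->
    exists n : nat, f @` restr B [set m | M m /\ (n <= m)%N] `<=` U.

(* A barrier is nonempty, so every map from B to X extends to {fset nat}. *)
Definition seq_compact (B : set {fset nat}) (X : topologicalType) : Prop :=
  forall f : {fset nat} -> X,
    exists2 M, infinite_set M & exists x, barrier_cvg M (restr B M) f x.

(* Main.v *)
Require Import Defs.
From HB Require Import structures.
From mathcomp Require Import all_boot all_order finmap.
From mathcomp Require Import boolp classical_sets functions cardinality filter.
From mathcomp Require Import wochoice topology.

Set Implicit Arguments.
Unset Strict Implicit.
Unset Printing Implicit Defensive.

Local Open Scope classical_set_scope.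

(* The space consists of isolated points for the finite sets of naturals, a
   point p_A for each member A of an almost disjoint family AA of sets in FIN^C,
   whose neighbourhoods contain almost all of A, and a point at infinity
   compactifying the rest. Points of C do not converge to p_A along C|M because
   A, being in FIN^C, contains no C|N; they do not converge to infinity if some
   A in AA meets C|(M \ n) for all n. For B-sequential compactness it suffices
   that every f : B -> C has a restriction to some B|N that is constant, or
   tends to infinity in the discrete sense and either maps into one A or is
   eventually off each A.

   AA is built by recursion of length c. By hypothesis f maps some B|N into a
   set D of FIN^C. The A's so far with their points p_A and infinity form a
   sequentially compact space of weight less than c = b, and in such a space
   maps on barriers have convergent restrictions. If the limit is infinity, D
   is recorded and later A's are chosen almost disjoint from it, so that f keeps
   converging to infinity. This is possible for fewer than b members of FIN^C,
   since each is avoided by all elements of C that are sparse enough, up to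
   finitely many minima. *)

(** * Barriers *)

Lemma infinite_natP (M : set nat) :
  infinite_set M <-> forall k, exists2 m, M m & (k <= m)%N.
Proof.
split=> [Minf k|Mub /finite_fsetP[A MA]].
  apply: contrapT => nk; apply: Minf.
  apply: (@sub_finite_set _ _ `I_k) => [m Mm /=|]; last exact: finite_II.
  by rewrite ltnNge; apply/negP => km; apply: nk; exists m.
have [m Mm] := Mub (\max_(i <- enum_fset A) i).+1.
have mA : m \in enum_fset A by move: Mm; rewrite MA.
by rewrite ltnNge (@leq_bigmax_seq _ (enum_fset A) xpredT id m mA).
Qed.

Lemma finite_nat_late (A : set nat) :
  finite_set A -> exists k, forall n, (k <= n)%N -> ~ A n.
Proof.
move=> finA; apply: contrapT => nk; suff : infinite_set A by [].
apply/infinite_natP => k; apply: contrapT => nex; apply: nk; exists k.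
by move=> n kn An; apply: nex; exists n.
Qed.

Lemma infinite_above (M : set nat) n :
  infinite_set M -> infinite_set (above M n).
Proof.
move=> /infinite_natP Minf; apply/infinite_natP => k.
have [m Mm km] := Minf (maxn k n.+1); exists m; last first.
  exact: leq_trans (leq_maxl _ _) km.
by split=> //; exact: leq_trans (leq_maxr _ _) km.
Qed.

Definition tail (M : set nat) (k : nat) : set nat := [set m | M m /\ (k <= m)%N].

Lemma infinite_tail (M : set nat) k :
  infinite_set M -> infinite_set (tail M k).
Proof.
move=> /infinite_natP Minf; apply/infinite_natP => l.
have [m Mm] := Minf (maxn k l); rewrite geq_max => /andP[km lm].
by exists m.
Qed.

Lemma range_increasing_ge (u : nat -> nat) :
  (forall k, (u k < u k.+1)%N) -> forall k, (k <= u k)%N.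
Proof. by move=> uS; elim=> // k IH; exact: leq_ltn_trans IH (uS k). Qed.

Lemma infinite_range_increasing (u : nat -> nat) :
  (forall k, (u k < u k.+1)%N) -> infinite_set (range u).
Proof.
move=> uS; apply/infinite_natP => k; exists (u k); first by exists k.
exact: range_increasing_ge.
Qed.

Lemma fset_natP (s : {fset nat}) : s = fset0 \/
  exists n t, s = (n |` t)%fset /\ forall m, m \in t -> (n < m)%N.
Proof.
have [->|/fset0Pn s0] := eqVneq s fset0; [by left|right].
case: (ex_minnP s0) => n ns nmin; exists n, (s `\ n)%fset; split.
  by rewrite fsetD1K.
move=> m; rewrite in_fsetD1 => /andP[mn ms].
by rewrite ltn_neqAle eq_sym mn nmin.
Qed.

Lemma sectionP (B : set {fset nat}) n t :
  section B n t <-> (forall m, m \in t -> (n < m)%N) /\ B (n |` t)%fset.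
Proof.
split=> [[s [Bs ns nmin] <-]|[tn Bt]].
  split; last by rewrite fsetD1K.
  move=> m; rewrite in_fsetD1 => /andP[mn ms].
  by rewrite ltn_neqAle eq_sym mn nmin.
have nt : n \notin t by apply/negP => /tn; rewrite ltnn.
exists (n |` t)%fset; last by rewrite fsetU1K.
split=> //; first by rewrite fset1U1.
by move=> m; rewrite in_fset1U => /orP[/eqP->//|/tn/ltnW].
Qed.

Lemma fset1U_inj n (s t : {fset nat}) :
  (forall m, m \in s -> (n < m)%N) -> (forall m, m \in t -> (n < m)%N) ->
  (n |` s)%fset = (n |` t)%fset -> s = t.
Proof.
move=> sn tn est.
have ns : n \notin s by apply/negP => /sn; rewrite ltnn.
have nt : n \notin t by apply/negP => /tn; rewrite ltnn.
by rewrite -(fsetU1K ns) est fsetU1K.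
Qed.

Section barrier_section.
Variables (M : set nat) (B : set {fset nat}).
Hypothesis MB : barrier M B.

Lemma barrier_fset0 : B fset0 -> B = [set fset0].
Proof.
case: MB => _ _ Bac _ B0; apply/seteqP; split=> [s Bs|s ->//] /=.
by apply/esym/Bac => // x.
Qed.

Lemma barrier_neq0 s : B <> [set fset0] -> B s ->
  exists n t, [/\ s = (n |` t)%fset, M n & section B n t].
Proof.
move=> B0 Bs; have [s0|[n [t [st tn]]]] := fset_natP s.
  by case: B0; apply: barrier_fset0; rewrite -s0.
exists n, t; split=> //; last by apply/sectionP; rewrite -st.
by have [_ /(_ _ Bs) + _ _] := MB; apply; rewrite /= st fset1U1.
Qed.

Lemma barrier_section n : B <> [set fset0] -> M n ->
  barrier (above M n) (section B n).
Proof.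
move=> B0 Mn; have [Minf BM Bac Bin] := MB; split.
- exact: infinite_above.
- move=> t /sectionP[tn /BM tM] m /= mt; split; last exact: tn.
  by apply: tM; rewrite /= fset1Ur.
- move=> s t /sectionP[sn Bs] /sectionP[tn Bt] st.
  apply: (@fset1U_inj n) => //; apply: Bac => // m /=.
  by rewrite !in_fset1U => /orP[->//|/st->]; rewrite orbT.
- move=> N Ninf NM.
  have [||s Bs [sN sin]] := Bin ([set n] `|` N).
  + by move=> finN; apply: Ninf; apply: sub_finite_set finN => m; right.
  + by move=> m [->//|/NM[]].
  have [k [t [st Mk /sectionP[tk Bt]]]] := barrier_neq0 B0 Bs.
  have ks : k \in s by rewrite st fset1U1.
  have kn : k = n.
    have [//|/NM[_ nk]] := sN k ks.
    have : n \in s by apply: (sin k n) => //; left.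
    rewrite st in_fset1U => /orP[/eqP->//|/tk].
    by rewrite ltnNge ltnW.
  subst k; exists t; first by apply/sectionP.
  split=> [m mt|i j it Nj ji].
    have ms : m \in s by rewrite st in_fset1U mt orbT.
    have [mn|//] := sN m ms.
    by have := tk m mt; rewrite mn ltnn.
  have : j \in s by apply: (sin i j) => //=; [rewrite st fset1Ur|right].
  rewrite st in_fset1U => /orP[/eqP jn|//].
  by have [_] := NM j Nj; rewrite jn ltnn.
Qed.

End barrier_section.

(** A counterexample has a section that is again one, and so on; the numbers n_0 < n_1 < ... met on
    the way form a set with an initial segment s in [B]. Removing the elements of s one by one ends
    in a section containing the empty set, that is in {emptyset}, where [Q] holds. *)
Lemma barrier_ind (Q : set nat -> set {fset nat} -> Prop) :
  (forall M, infinite_set M -> Q M [set fset0]) ->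
  (forall M B, barrier M B -> B <> [set fset0] ->
     (forall n, M n -> Q (above M n) (section B n)) -> Q M B) ->
  forall M B, barrier M B -> Q M B.
Proof.
move=> Q0 QS M0 B0 MB0; apply: contrapT => nQ.
pose bad (x : set nat * set {fset nat}) := barrier x.1 x.2 /\ ~ Q x.1 x.2.
pose next (x : set nat * set {fset nat}) n := (above x.1 n, section x.2 n).
have bad0 x : bad x -> x.2 <> [set fset0].
  by move=> [[xinf _ _ _] nQx] x0; apply: nQx; rewrite x0; exact: Q0.
have badS x : exists n, bad x -> x.1 n /\ bad (next x n).
  have [bx|nbx] := pselect (bad x); last by exists 0%N.
  apply: contrapT => nex; have [xb nQx] := bx; apply: nQx.
  apply: QS => // [|n xn]; first exact: bad0.
  apply: contrapT => nQn; apply: nex; exists n => _; split=> //; split=> //.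
  by apply: barrier_section => //; exact: bad0.
have [F FP] := choice badS.
pose st x k := iter k (fun y => next y (F y)) x.
have badst x k : bad x -> bad (st x k).
  by move=> bx; elim: k => //= k /FP[].
have FS x k : bad x -> (F (st x k) < F (st x k.+1))%N.
  by move=> bx; have /FP[[]] := @badst x k.+1 bx.
have Fmono x k : bad x -> x.1 (F (st x k)).
  move=> bx; have : (st x k).1 `<=` x.1.
    by elim: k => //= k IH m []; auto.
  by apply; have /FP[] := @badst x k bx.
suff noseg s x : bad x -> x.2 s ->
    ~ initial_segment [set` s] (range (fun k => F (st x k))).
  have bx : bad (M0, B0) by [].
  have [_ _ _ /(_ (range (fun k => F (st (M0, B0) k))))[]] := MB0.
  - by apply: infinite_range_increasing => k; exact: FS.
  - by move=> _ [k _ <-]; exact: (Fmono (M0, B0)).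
  - by move=> s B0s; exact: (@noseg s (M0, B0)).
have [k sk] := ubnP #|` s|; elim: k s sk x => // k IH s sk x bx xs [sN sin].
have [n [t [est xn /sectionP[tn xt]]]] := barrier_neq0 bx.1 (bad0 _ bx) xs.
(* If the least element [n] of [s] were a later term, [F x] would lie below it and so belong to
   [s]. *)
have nF : n = F x.
  have ns : n \in s by rewrite est fset1U1.
  have [[|j] _ jn] := sN n ns; first by rewrite -jn.
  have lt0 : (F x < F (st x j.+1))%N.
    elim: j {jn} => [|j IHj]; first exact: (@FS x 0%N).
    by apply: ltn_trans IHj _; exact: FS.
  have : F x \in s.
    by apply: (sin n (F x)) => //; [exists 0%N|rewrite -jn].
  rewrite est in_fset1U => /orP[/eqP//|/tn].
  by rewrite -jn ltnNge ltnW.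
have nt : n \notin t by apply/negP => /tn; rewrite ltnn.
have [Fx1 bSx] := FP x bx.
apply: (IH t _ (next x (F x)) bSx).
- by move: sk; rewrite est cardfsU1 nt add1n ltnS.
- by rewrite -nF; apply/sectionP.
have stS j : st (next x (F x)) j = st x j.+1 by rewrite /st iterSr.
split=> [m mt|i j it [l _ <-] ji].
  have ms : m \in s by rewrite est in_fset1U mt orbT.
  have [[|j] _ jm] := sN m ms.
  - by have := tn m mt; rewrite nF -jm ltnn.
  - by exists j => //; rewrite stS.
have : F (st x l.+1) \in s.
  apply: (sin i) => //=; [by rewrite est fset1Ur|by exists l.+1|].
  by move: ji; rewrite stS.
rewrite stS est in_fset1U => /orP[/eqP Fn|//].
have := badst x l.+1 bx.
have : (F x < F (st x l.+1))%N.
  elim: l {ji Fn} => [|l IHl]; first exact: (@FS x 0%N).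
  by apply: ltn_trans IHl _; exact: FS.
by rewrite Fn nF ltnn.
Qed.

(** Diagonal argument: [N] is shrunk to K_0, K_1, ... with u_k in K_k and R u_k K_(k+1). Every u_l
    beyond u_k lies in K_(k+1), and [R] is inherited by infinite subsets. *)
Lemma fusion (R : nat -> set nat -> Prop) (N : set nat) :
  infinite_set N ->
  (forall n K, N n -> infinite_set K -> K `<=` above N n ->
     exists K', [/\ infinite_set K', K' `<=` K & R n K']) ->
  (forall n K K', infinite_set K' -> K' `<=` K -> R n K -> R n K') ->
  exists N', [/\ infinite_set N', N' `<=` N &
    forall n, N' n -> R n (above N' n)].
Proof.
move=> Ninf Rex Rsub.
have stepP (K : set nat) : exists p : nat * set nat,
    infinite_set K -> K `<=` N ->
    [/\ K p.1, infinite_set p.2, p.2 `<=` above K p.1 & R p.1 p.2].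
  have [[Kinf KN]|nK] := pselect (infinite_set K /\ K `<=` N); last first.
    by exists (0%N, K) => ? ?; case: nK.
  have /infinite_natP/(_ 0%N)[n Kn _] := Kinf.
  have [||K' [K'inf K'K RK']] := Rex n (above K n) (KN _ Kn).
  - exact: infinite_above.
  - by move=> m [/KN].
  - by exists (n, K').
have [F FP] := choice stepP.
pose K k := iter k (fun K => (F K).2) N.
have Kp k : infinite_set (K k) /\ K k `<=` N.
  elim: k => [|k [Kinf KN]] /=; first by split.
  have [FK Finf Fab _] := FP _ Kinf KN.
  by split=> // m /Fab[/KN].
pose u k := (F (K k)).1.
have Kab k : K k.+1 `<=` above (K k) (u k).
  by have [? ?] := Kp k; have [] := FP (K k).
have uK k : K k (u k) by have [? ?] := Kp k; have [] := FP (K k).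
have Ksub k l : (k <= l)%N -> K l `<=` K k.
  move=> /subnK <-; elim: (l - k)%N => //= j IH m Km.
  by apply: IH; have [] := Kab _ _ Km.
have uS k : (u k < u k.+1)%N by have [] := Kab _ _ (uK k.+1).
have umono k l : (k <= l)%N -> (u k <= u l)%N.
  move=> /subnK <-; elim: (l - k)%N => //= j IH.
  by apply: leq_trans IH _; apply: ltnW; exact: uS.
have uinf : infinite_set (range u) by exact: infinite_range_increasing.
exists (range u); split=> // [_ [k _ <-]|_ [k _ <-]].
  by have [_] := Kp k; apply.
have [Kinf KN] := Kp k; have [_ _ _] := FP (K k) Kinf KN.
apply: Rsub; first exact: infinite_above.
move=> _ [[l _ <-] ul]; have kl : (k < l)%N.
  by rewrite ltnNge; apply/negP => /umono; rewrite leqNgt ul.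
exact: (Ksub k.+1 l).
Qed.

Definition sparse (g : nat -> nat) (N : set nat) : Prop :=
  forall m n, N m -> N n -> (m < n)%N -> (g m <= n)%N.

Lemma sparse_subset (g : nat -> nat) (N : set nat) : infinite_set N ->
  exists N', [/\ infinite_set N', N' `<=` N & sparse g N'].
Proof.
move=> Ninf; have [//|||N' [N'inf N'N N'P]] :=
  @fusion (fun n K => K `<=` [set m | g n <= m]%N) N.
- move=> n K _ Kinf _; exists (tail K (g n)); split.
  + exact: infinite_tail.
  + by move=> m [].
  + by move=> m [].
- by move=> n K K' _ K'K /(subset_trans K'K).
- by exists N'; split=> // m n N'm N'n mn; apply: (N'P m).
Qed.

(** * Convergence along barriers with fewer than b coordinates *)

Lemma le_starP f g :
  le_star f g <-> exists k, forall n, (k <= n)%N -> (f n <= g n)%N.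
Proof.
split=> [[k _ kP]|[k kP]]; first by exists k.
by exists k.
Qed.

Lemma restrS (B : set {fset nat}) (M N : set nat) :
  N `<=` M -> restr B N `<=` restr B M.
Proof. by move=> NM s [Bs sN]; split=> //; exact: subset_trans sN NM. Qed.

Lemma tailS (M N : set nat) k l :
  N `<=` M -> (k <= l)%N -> tail N l `<=` tail M k.
Proof.
by move=> NM kl m [Nm lm]; split; [exact: NM|exact: leq_trans kl lm].
Qed.

Lemma tail_sub (M : set nat) k : tail M k `<=` M.
Proof. by move=> m []. Qed.

Definition eventually_on (B : set {fset nat}) (N : set nat)
    (P : set {fset nat}) : Prop :=
  exists k, restr B (tail N k) `<=` P.

Lemma eventually_onS (B : set {fset nat}) (M N : set nat)
    (P Q : set {fset nat}) :
  N `<=` M -> P `<=` Q -> eventually_on B M P -> eventually_on B N Q.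
Proof.
move=> NM PQ [k kP]; exists k => s Bs.
by apply/PQ/kP; apply: restrS Bs; exact: tailS.
Qed.

Lemma eventually_onI (B : set {fset nat}) (N : set nat)
    (P Q : set {fset nat}) :
  eventually_on B N P -> eventually_on B N Q -> eventually_on B N (P `&` Q).
Proof.
move=> [k kP] [l lQ]; exists (maxn k l) => s Bs; split.
  by apply: kP; apply: restrS Bs; apply: tailS => //; exact: leq_maxl.
by apply: lQ; apply: restrS Bs; apply: tailS => //; exact: leq_maxr.
Qed.

(* The index types of families of functions that are not unbounded, that is,
   those of cardinality less than b. *)
Definition small (I : Type) : Prop :=
  forall G : I -> nat -> nat, exists g, forall i, le_star (G i) g.

Lemma small_nat : small nat.
Proof.
move=> G; exists (fun n => \max_(i < n.+1) G i n) => i.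
apply/le_starP; exists i => n ni.
by rewrite (leq_bigmax (Ordinal (ni : i < n.+1)%N)).
Qed.

Lemma small_unit : small unit.
Proof. by move=> G; exists (G tt) => -[]; apply/le_starP; exists 0%N. Qed.

(** This is sequential compactness of [Y] as a subspace of the power 2^I. *)
Definition pointwise_seq_compact (I : Type) (Y : set (I -> Prop)) : Prop :=
  forall (u : nat -> I -> Prop) N, (forall n, Y (u n)) -> infinite_set N ->
    exists N', [/\ infinite_set N', N' `<=` N & exists2 y, Y y &
      forall i, exists k, forall n, N' n -> (k <= n)%N -> u n i <-> y i].

(* In the inductive step the values on the sections converge to points y_n,
   these converge to y along a subset, and as there are fewer than b
   coordinates the moduli of convergence of all sections are dominated by a
   single function g, so that it suffices to thin the set out according to g. *)
Lemma barrier_pointwise_cvg (I : Type) (Y : set (I -> Prop)) M B :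
  small I -> pointwise_seq_compact Y -> barrier M B ->
  forall (f : {fset nat} -> I -> Prop) N,
    (forall s, Y (f s)) -> infinite_set N -> N `<=` M ->
    exists N', [/\ infinite_set N', N' `<=` N & exists2 y, Y y &
      forall i, eventually_on B N' [set s | f s i <-> y i]].
Proof.
move=> Ismall Yseq; move: M B; apply: barrier_ind => [M _|M B MB B0 IH] f N Yf.
  move=> Ninf _; exists N; split=> //; exists (f fset0) => // i.
  by exists 0%N => s [->].
move=> Ninf NM.
pose f_ n t := f (n |` t)%fset.
pose R n K := exists2 y, Y y &
  forall i, eventually_on (section B n) K [set t | f_ n t i <-> y i].
have [N1 [N1inf N1N N1P]] : exists N', [/\ infinite_set N', N' `<=` N &
    forall n, N' n -> R n (above N' n)].
  apply: fusion => // [n K Nn Kinf KN|n K K' K'inf K'K [y Yy yP]].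
    have [|//||K' [K'inf K'K KP]] := IH n (NM _ Nn) (f_ n) K.
    - by move=> t; exact: Yf.
    - by move=> m /KN[/NM].
    - by exists K'.
  by exists y => // i; apply: eventually_onS (yP i).
have [u uP] : exists u : nat -> I -> Prop, forall n, Y (u n) /\
    (N1 n -> forall i, eventually_on (section B n) (above N1 n)
                         [set t | f_ n t i <-> u n i]).
  suff /choice[u uP] : forall n, exists y : I -> Prop, Y y /\
      (N1 n -> forall i, eventually_on (section B n) (above N1 n)
                           [set t | f_ n t i <-> y i]) by exists u.
  move=> n; have [/N1P[y Yy yP]|nN1] := pselect (N1 n); first by exists y.
  by exists (f fset0).
have [N2 [N2inf N2N1 [y Yy yP]]] := Yseq u N1 (fun n => (uP n).1) N1inf.
have /choice[G GP] : forall i, exists G : nat -> nat, forall n, N1 n ->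
    restr (section B n) (tail (above N1 n) (G n)) `<=`
      [set t | f_ n t i <-> u n i].
  move=> i; suff /choice[G GP] : forall n, exists k, N1 n ->
      restr (section B n) (tail (above N1 n) k) `<=`
        [set t | f_ n t i <-> u n i] by exists G.
  move=> n; have [Nn|nN] := pselect (N1 n); last by exists 0%N.
  by have [_ /(_ Nn i)[k kP]] := uP n; exists k.
have [g gP] := Ismall G.
have [N3 [N3inf N3N2 N3P]] := sparse_subset g N2inf.
exists N3; split=> //; first by move=> m /N3N2/N2N1/N1N.
exists y => // i; have [k kP] := yP i; have /le_starP[l lP] := gP i.
(* Beyond [k] the points u_n agree with [y] at [i]. Beyond [l] the function [g] bounds [G i], so by
   sparseness the rest of s lies where [f_ n] agrees with u_n at [i]. *)
exists (maxn k l) => s [Bs sN3] /=.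
have [n [t [st Mn Bt]]] := barrier_neq0 MB B0 Bs; have /sectionP[tn _] := Bt.
have ns : n \in s by rewrite st fset1U1.
have [N3n] := sN3 n ns; rewrite geq_max => /andP[kn ln].
have N1n := N2N1 _ (N3N2 _ N3n).
suff : f_ n t i <-> u n i.
  by rewrite /f_ -st => ->; apply: kP => //; exact: N3N2.
apply: (GP i n N1n); split=> // m mt.
have ms : m \in s by rewrite st fset1Ur.
have [N3m _] := sN3 m ms; split.
  by split; [exact/N2N1/N3N2|exact: tn].
by apply: leq_trans (lP n ln) _; apply: (N3P n m) => //; exact: tn.
Qed.

(* The point i of I stands for a limit point delta_i and 0 for the point at
   infinity. *)
Lemma almost_disjoint_seq_compact (I : Type) (Y : set (I -> Prop)) :
  Y (fun=> False) -> (forall i, Y (fun j => j = i)) ->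
  (forall i j, i <> j -> finite_set [set y | [/\ Y y, y i & y j]]) ->
  pointwise_seq_compact Y.
Proof.
move=> Y0 Yd Yad u N Yu Ninf.
pose S i := [set n | N n /\ u n i].
(* If no coordinate holds infinitely often, the limit is 0. If [S i] is infinite and shares
   infinitely many indices with another [S j], the terms there come from a finite set and a constant
   subsequence exists. Otherwise delta_i is the limit along [S i]. *)
have [[i Si]|nS] := pselect (exists i, infinite_set (S i)); last first.
  exists N; split=> //; exists (fun=> False) => // i.
  have [|k kP] := @finite_nat_late (S i).
    by apply: contrapT => Si; apply: nS; exists i.
  by exists k => n Nn kn; split=> // uni; case: (kP n kn).
have [[j [ij Sij]]|nSS] :=
    pselect (exists j, i <> j /\ infinite_set (S i `&` S j)).
  have [y yinf] : exists y, infinite_set (S i `&` S j `&` [set n | u n = y]).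
    apply: contrapT => nex; apply: Sij.
    pose C y := S i `&` S j `&` [set n | u n = y].
    apply: (@sub_finite_set _ _
        (\bigcup_(y in [set y | [/\ Y y, y i & y j]]) C y)).
      move=> n [[Nn ni] [_ nj]]; exists (u n); first by split.
      by split.
    apply: bigcup_finite; first exact: Yad.
    by move=> y _; apply: contrapT => yf; apply: nex; exists y.
  exists (S i `&` S j `&` [set n | u n = y]); split=> //.
    by move=> n [[[]]].
  have /infinite_natP/(_ 0%N)[n [_ /= un] _] := yinf.
  exists y; last by move=> l; exists 0%N => m [_ /= ->].
  by rewrite -un.
exists (S i); split=> //; first by move=> n [].
exists (fun j => j = i) => // j.
have [->|ij] := pselect (j = i); first by exists 0%N => n [].
have [|k kP] := @finite_nat_late (S i `&` S j).
  apply: contrapT => Sij; apply: nSS; exists j; split=> //.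
  by move=> e; apply: ij.
exists k => n [Nn ni] kn; split=> [nj|/ij//].
by case: (kP n kn); split.
Qed.

(** * The ideal FIN *)

(** The one-coordinate case of the convergence theorem: a convergent map to a two-point discrete
    space is eventually constant. *)
Lemma nash_williams M B (P : set {fset nat}) N :
  barrier M B -> infinite_set N -> N `<=` M ->
  exists N', [/\ infinite_set N', N' `<=` N &
    restr B N' `<=` P \/ restr B N' `<=` ~` P].
Proof.
move=> MB Ninf NM.
have Ycpt : pointwise_seq_compact [set: unit -> Prop].
  by apply: almost_disjoint_seq_compact => // -[] [].
have [//|N' [N'inf N'N [y _ /(_ tt)[k kP]]]] :=
  barrier_pointwise_cvg small_unit Ycpt MB (f := fun s _ => P s) _ Ninf NM.
exists (tail N' k); split; first exact: infinite_tail.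
  exact: subset_trans (@tail_sub _ _) N'N.
have [yt|yt] := pselect (y tt); [left|right] => s /kP /= sy.
  by apply/sy.
by move/sy.
Qed.

Lemma fset_nat_countable : exists code : {fset nat} -> nat, injective code.
Proof.
exists (@choice.pickle {fset (nat : countType)}).
exact: pcan_inj (@choice.pickleK _).
Qed.

(** The values form a countable discrete space. Convergence in its one-point compactification,
    described by countably many coordinates, means being eventually constant or leaving every
    value. *)
Lemma constant_or_finite_to_one (T : Type) M B (f : {fset nat} -> T) N :
  barrier M B -> infinite_set N -> N `<=` M ->
  exists N', [/\ infinite_set N', N' `<=` N &
    (exists c, restr B N' `<=` [set s | f s = c]) \/
    (forall c, eventually_on B N' [set s | f s <> c])].
Proof.
move=> MB Ninf NM.
(* A value is coded by a chosen argument attaining it, as only the domain is known to be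
   countable. *)
have [rep repP] : exists rep : T -> {fset nat}, forall s, f (rep (f s)) = f s.
  suff /choice[rep repP] : forall x, exists s, (exists s', f s' = x) -> f s = x.
    by exists rep => s; apply: repP; exists s.
  move=> x; have [[s sx]|nx] := pselect (exists s', f s' = x).
    by exists s.
  by exists fset0 => /nx.
have [code code_inj] := fset_nat_countable; pose h s := code (rep (f s)).
pose Y : set (nat -> Prop) :=
  [set y | y = (fun=> False) \/ exists i, y = (fun j => j = i)].
have Ycpt : pointwise_seq_compact Y.
  apply: almost_disjoint_seq_compact => [|i|i j ij]; first by left.
    by right; exists i.
  apply: (@sub_finite_set _ _ set0) => // y [[->//|[k ->] ik jk]].
  by case: ij; rewrite ik jk.
have [|N' [N'inf N'N [y [y0|[i yi]] yP]]] :=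
  barrier_pointwise_cvg small_nat Ycpt MB (f := fun s j => j = h s) _ Ninf NM.
- by move=> s; right; exists (h s).
- exists N'; split=> //; right => c.
  have [[s' s'c]|nc] := pselect (exists s', f s' = c); last first.
    by exists 0%N => s _ sc; apply: nc; exists s.
  have [k kP] := yP (h s'); exists k => s /kP /=; rewrite y0 => -[+ _] sc.
  by apply; rewrite /h sc s'c.
- have [k kP] := yP i; exists (tail N' k); split.
  + exact: infinite_tail.
  + exact: subset_trans (@tail_sub _ _) N'N.
  left; have [[s0 s0i]|nos] := pselect (exists s, i = h s).
    exists (f s0) => s /kP /=; rewrite yi => -[_ /(_ erefl)].
    by rewrite s0i => /code_inj e; rewrite -[LHS]repP -e repP.
  exists (f fset0) => s /kP /=; rewrite yi => -[_ /(_ erefl) si].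
  by case: nos; exists s.
Qed.

Lemma FIN_avoid M B : barrier M B -> forall D, FIN M B D ->
  exists k g, forall s, B s -> (forall m, m \in s -> (k <= m)%N) ->
    sparse g [set` s] -> ~ D s.
Proof.
move: M B; apply: barrier_ind => [M Minf|M B MB B0 IH] D.
  by move=> /FIN_trivialE ->; exists 0%N, id => s _ _ _ [].
move=> /(FIN_recE _ _ B0)[DB /finite_nat_late[k kP]].
have /choice[p pP] : forall n, exists p : nat * (nat -> nat),
    M n -> (k <= n)%N -> forall t, section B n t ->
    (forall m, m \in t -> (p.1 <= m)%N) -> sparse p.2 [set` t] ->
    ~ section D n t.
  move=> n; have [[Mn kn]|nn] := pselect (M n /\ (k <= n)%N); last first.
    by exists (0%N, id) => ? ?; case: nn.
  have /IH : FIN (above M n) (section B n) (section D n).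
    by apply: contrapT => nF; exact: (kP n kn).
  by move=> /(_ Mn)[l [g gP]]; exists (l, g).
(* [k] lies beyond the exceptional n. At the minimum n of s the first component pushes the rest of s
   beyond the bound of the n-th section; at a later element m the maximum covers the function of
   that section because n < m. *)
exists k, (fun n => maxn (p n).1 (\max_(i < n.+1) (p i).2 n)).
move=> s Bs sk ssp Ds.
have [n [t [st Mn Bt]]] := barrier_neq0 MB B0 Bs; have /sectionP[tn _] := Bt.
have ns : n \in s by rewrite st fset1U1.
have ts m : m \in t -> m \in s by move=> mt; rewrite st fset1Ur.
apply: (pP n Mn (sk _ ns) t Bt); last by apply/sectionP; rewrite -st.
  move=> m mt; have := ssp n m ns (ts _ mt) (tn _ mt).
  by rewrite geq_max => /andP[].
move=> m m' mt m't mm'; have := ssp m m' (ts _ mt) (ts _ m't) mm'.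
rewrite geq_max => /andP[_]; apply: leq_trans.
have nm : (n < m.+1)%N by rewrite ltnS ltnW// tn.
exact: (leq_bigmax (F := fun i : 'I_m.+1 => (p i).2 m) (Ordinal nm)).
Qed.

(** One [g] eventually dominates the functions that [FIN_avoid] attaches to the [D i], so a
    [g]-sparse set works for each [i] from some point on. *)
Lemma FIN_small_avoid (I : Type) M B (D : I -> set {fset nat}) N :
  small I -> barrier M B -> (forall i, FIN M B (D i)) ->
  infinite_set N -> N `<=` M ->
  exists N', [/\ infinite_set N', N' `<=` N &
    forall i, eventually_on B N' (~` D i)].
Proof.
move=> Ismall MB DF Ninf NM.
have /choice[p pP] : forall i, exists p : nat * (nat -> nat), forall s,
    B s -> (forall m, m \in s -> (p.1 <= m)%N) ->
    sparse p.2 [set` s] -> ~ D i s.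
  by move=> i; have [k [g kg]] := FIN_avoid MB (DF i); exists (k, g).
have [g gP] := Ismall (fun i => (p i).2).
have [N' [N'inf N'N N'P]] := sparse_subset g Ninf.
exists N'; split=> // i; have /le_starP[l lP] := gP i.
exists (maxn (p i).1 l) => s [Bs sN']; apply: pP => // [m /sN'[_]|m m'].
  by rewrite geq_max => /andP[].
move=> /sN'[N'm]; rewrite geq_max => /andP[_ lm] /sN'[N'm' _] mm'.
by apply: leq_trans (lP m lm) _; exact: N'P.
Qed.

Lemma FIN_set0 M B : barrier M B -> FIN M B set0.
Proof.
move: M B; apply: barrier_ind => [M Minf|M B MB B0 IH]; first exact: FIN_trivial.
apply: (FIN_rec (E := set0)) => // n Mn _.
have -> : section set0 n = set0 by rewrite -subset0 => t /sectionP[].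
exact: IH.
Qed.

Lemma FIN_finite M B X : barrier M B -> B <> [set fset0] ->
  X `<=` B -> finite_set X -> FIN M B X.
Proof.
move=> MB B0 XB finX.
apply: (FIN_rec (E := \bigcup_(s in X) [set` s])) => //.
  by apply: bigcup_finite => // s _; exact: finite_fset.
move=> n Mn nE; suff -> : section X n = set0.
  by apply/FIN_set0/barrier_section.
rewrite -subset0 => t /sectionP[_ Xt]; apply: nE; exists (n |` t)%fset => //.
by rewrite /= fset1U1.
Qed.

(** [A] consists of one a_k from each tail of a set avoiding all [D i]. A number n lies in a_k only
    for k <= n, so the sections of [A] are finite. This puts them in FIN except over a section
    {emptyset}, whose ideal contains only the empty set. *)
Lemma FIN_transversal (I : Type) M B (D : I -> set {fset nat}) N :
  small I -> barrier M B -> B <> [set fset0] ->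
  finite_set [set n | section B n = [set fset0]] ->
  (forall i, FIN M B (D i)) -> infinite_set N -> N `<=` M ->
  exists A, [/\ FIN M B A, forall i, finite_set (A `&` D i) &
    forall n, exists2 s, A s & restr B (tail N n) s].
Proof.
move=> Ismall MB B0 B1 DF Ninf NM.
have [N' [N'inf N'N N'P]] := FIN_small_avoid Ismall MB DF Ninf NM.
have /choice[a aP] : forall n, exists s, restr B (tail N' n) s.
  move=> n; have [_ _ _ /(_ (tail N' n))[||s Bs [sN _]]] := MB.
  - exact: infinite_tail.
  - by move=> m [/N'N/NM].
  - by exists s.
have finD (A : set {fset nat}) k : (forall n, A (a n) -> (n < k)%N) ->
    finite_set (range a `&` A).
  move=> Ak; apply: (@sub_finite_set _ _ (a @` `I_k)).
    by move=> _ [[n _ <-] An]; exists n => //; exact: Ak.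
  by apply: finite_image; exact: finite_II.
have aB : range a `<=` B by move=> _ [n _ <-]; have [] := aP n.
exists (range a); split=> [|i|n].
- apply: (FIN_rec B0 aB B1) => n Mn n1.
  apply: (FIN_finite (barrier_section MB B0 Mn) n1).
    by move=> t /sectionP[tn /aB Bt]; apply/sectionP.
  apply: (@sub_finite_set _ _
    ((fun s : {fset nat} => (s `\ n)%fset) @` (range a `&` [set s | n \in s]))).
    move=> t /sectionP[tn at_]; exists (n |` t)%fset.
      by split=> //=; rewrite fset1U1.
    by rewrite fsetU1K//; apply/negP => /tn; rewrite ltnn.
  apply/finite_image/(finD _ n.+1) => k /= nk.
  by have [_ /(_ _ nk)[]] := aP k.
- have [k kP] := N'P i; apply: (finD _ k) => n Dn; rewrite ltnNge.
  apply/negP => kn; apply: kP Dn; apply: restrS (aP n); exact: tailS.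
- by exists (a n); [exists n|apply: restrS (aP n); exact: tailS].
Qed.

(** * Recursion of length the continuum *)

Lemma transfinite_choice (J V : Type) (R : J -> J -> Prop) (v0 : V)
    (P : J -> (J -> V) -> V -> Prop) :
  well_founded R ->
  (forall j h h' v, (forall i, R i j -> h i = h' i) -> P j h v -> P j h' v) ->
  (forall j h, (forall i, R i j -> P i h (h i)) -> exists v, P j h v) ->
  exists h, forall j, P j h (h j).
Proof.
move=> wfR Pext Pex.
have /choice[pick pickP] : forall jh : J * (J -> V), exists v,
    (exists v, P jh.1 jh.2 v) -> P jh.1 jh.2 v.
  move=> jh; have [[v Pv]|nP] := pselect (exists v, P jh.1 jh.2 v).
    by exists v.
  by exists v0.
(* The history below [j] is completed by a default, so that [pick] can act on total functions; by
   [Pext] the default has no influence. *)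
pose ext j (rec : forall i, R i j -> V) i :=
  if pselect (R i j) is left Rij then rec i Rij else v0.
pose F j rec := pick (j, ext j rec).
pose h := Fix wfR (fun=> V) F.
have hE j : h j = pick (j, ext j (fun i _ => h i)).
  rewrite /h Fix_eq // => i f g fg; rewrite /F; congr (pick (_, _)).
  by apply/funext => k; rewrite /ext; case: pselect.
exists h; elim/(well_founded_ind wfR) => j IH.
have hh i : R i j -> h i = ext j (fun i _ => h i) i.
  by move=> Rij; rewrite /ext; case: pselect.
have [v Pv] := Pex j h IH.
rewrite hE; apply: (@Pext j (ext j (fun i _ => h i))).
  by move=> i Rij; rewrite -hh.
by apply: (pickP (j, _)); exists v; exact: Pext Pv.
Qed.

(** Unique least elements of pairs give reflexivity, totality and antisymmetry; a least inaccessible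
    point would contradict its own inaccessibility. *)
Lemma strict_well_order (T : eqType) : exists R : T -> T -> Prop,
  well_founded R /\ forall x y, x <> y -> R x y \/ R y x.
Proof.
have [R Rwo] := well_ordering_principle T.
have pairP x y : exists2 z, (z = x \/ z = y) & R z x /\ R z y.
  have [|z [[zxy zmin] _]] := Rwo [pred w | (w == x) || (w == y)].
    by exists x; rewrite inE eqxx.
  exists z; last by split; apply: zmin; rewrite inE eqxx ?orbT.
  by move: zxy; rewrite inE => /orP[]/eqP; [left|right].
have Rtot x y : R x y \/ R y x.
  by have [z [->|->] []] := pairP x y; [left|right].
have Rrefl x : R x x by have [z [->|->] []] := pairP x x.
have Ranti x y : R x y -> R y x -> x = y.
  move=> xy yx; have [|z [_ zuniq]] := Rwo [pred w | (w == x) || (w == y)].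
    by exists x; rewrite inE eqxx.
  rewrite -(zuniq x); last first.
    by split=> [|w]; rewrite !inE ?eqxx// => /orP[]/eqP->.
  apply: zuniq.
  by split=> [|w]; rewrite !inE ?eqxx ?orbT// => /orP[]/eqP->.
pose lt x y := R x y /\ x <> y.
exists lt; split=> [|x y xy]; last first.
  by have [] := Rtot x y; [left|right]; split=> // /esym.
move=> x; apply: contrapT => nx.
have [|z [[zA zmin] _]] := Rwo [pred w | `[< ~ Acc lt w >]].
  by exists x; apply/asboolP.
move/asboolP: zA; apply; split=> y [yz ynz]; apply: contrapT => ny.
by apply: ynz; apply: Ranti => //; apply: zmin; apply/asboolP.
Qed.

(** An unbounded range of [G] would have at least b = c elements, but it is no larger than [A]. *)
Lemma small_of_card (I T : Type) (A : set T) (v : I -> T) :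
  b_eq_c -> injective v -> (forall i, A (v i)) ->
  ~ ([set: set nat] #<= A)%card -> small I.
Proof.
move=> [F [_ Fmin Fc]] vinj vA nA G; apply: contrapT => nG; apply: nA.
have Gunb : unbounded (range G).
  move=> [g gP]; apply: nG; exists g => i; apply: gP; by exists i.
have /choice[g gP] : forall y, exists f, forall i, v i = y -> G i = f.
  move=> y; have [[i iy]|ny] := pselect (exists i, v i = y).
    by exists (G i) => k; rewrite -iy => /vinj->.
  by exists id => i iy; case: ny; exists i.
have GA : (range G #<= A)%card.
  apply: card_le_trans (card_image_le g A); apply: subset_card_le.
  by move=> _ [i _ <-]; exists (v i) => //; rewrite (gP (v i) i).
have {Fc} /card_eqPle[_ cF] := Fc.
exact: card_le_trans cF (card_le_trans (Fmin _ Gunb) GA).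
Qed.

(** [J] stands for the cardinal c: the power set of the naturals, well ordered, or the first initial
    segment of it that has full size. Its proper initial segments have size less than c = b, and it
    enumerates [T] because [T] embeds in the power set. *)
Lemma small_well_order (T : Type) (t0 : T) (e : T -> set nat) :
  b_eq_c -> injective e ->
  exists (J : Type) (R : J -> J -> Prop),
    [/\ well_founded R, forall i j, i <> j -> R i j \/ R j i,
        forall j, small {i | R i j} &
        exists f : J -> T, forall t, exists j, f j = t].
Proof.
move=> bc einj; have [lt [ltwf lttot]] := strict_well_order (set nat).
pose big (S : set (set nat)) := ([set: set nat] #<= S)%card.
have [S [Sbig Ssmall]] : exists S : set (set nat), big S /\
    forall x, S x -> ~ big [set y | S y /\ lt y x].
  have [[x xbig]|nobig] := pselect (exists x, big [set y | lt y x]); last first.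
    exists setT; split=> [|x _ xbig]; first exact: card_lexx.
    apply: nobig; exists x; apply: card_le_trans xbig _.
    by apply: subset_card_le => y [].
  move: xbig; elim/(well_founded_ind ltwf): x => x IH xbig.
  have [[y [yx ybig]]|nob] := pselect (exists y, lt y x /\ big [set z | lt z y]).
    exact: IH yx ybig.
  exists [set y | lt y x]; split=> // y yx ybig; apply: nob; exists y; split=> //.
  by apply: card_le_trans ybig _; apply: subset_card_le => z [].
exists {x | S x}, (fun x y => lt (sval x) (sval y)).
have sval_inj (Q : set (set nat)) : injective (@sval _ Q).
  by move=> [x Qx] [y Qy] /= xy; exact: eq_exist.
split.
- move=> [x Sx]; elim/(well_founded_ind ltwf): x Sx => x IH Sx.
  by split=> -[y Sy] yx; exact: IH.
- by move=> i j ij; apply: lttot => /sval_inj.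
- move=> [x Sx].
  apply: (small_of_card bc (v := fun i => sval (sval i)) _ _ (Ssmall x Sx)).
    move=> [i ix] [k kx] /= /sval_inj ik; exact: eq_exist.
  by move=> [[y Sy] yx].
- have /pcard_surjP[g gsurj] := Sbig.
  have /choice[d dP] : forall x, exists t, forall t', e t' = x -> t = t'.
    move=> x; have [[t tx]|nt] := pselect (exists t, e t = x).
      by exists t => t'; rewrite -tx => /einj.
    by exists t0 => t tx; case: nt; exists t.
  exists (fun x => d (g (sval x))) => t.
  have [x Sx xt] := gsurj (e t) I.
  by exists (exist _ x Sx); apply: dP.
Qed.

Lemma task_injection : exists e : ({fset nat} -> {fset nat}) * set nat -> set nat,
  injective e.
Proof.
have [c cinj] := fset_nat_countable.
pose p (x y : nat) := choice.pickle (x, y).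
have pinj x y x' y' : p x y = p x' y' -> x = x' /\ y = y'.
  by move=> /(pcan_inj (@choice.pickleK _))[].
(* First coordinate 0 marks the elements of the set, a positive one the graph of the map. *)
exists (fun t => [set k | (exists s, k = p (c s).+1 (c (t.1 s))) \/
                     (exists2 n, t.2 n & k = p 0%N n)]).
move=> [f N] [g M] /= /seteqP[fg gf]; congr (_, _).
  apply/funext => s; have [|[s']|[n _]] := fg (p (c s).+1 (c (f s))).
  - by left; exists s.
  - by move=> /pinj[[/cinj <-] /cinj].
  - by move=> /pinj[].
apply/seteqP; split=> n nN.
  have [|[s]|[m]] := fg (p 0%N n).
  - by right; exists n.
  - by move=> /pinj[].
  - by move=> ? /pinj[_ ->].
have [|[s]|[m]] := gf (p 0%N n).
- by right; exists n.
- by move=> /pinj[].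
- by move=> ? /pinj[_ ->].
Qed.

(** * The almost disjoint family *)

Lemma small_sum (I J : Type) : small I -> small J -> small (I + J).
Proof.
move=> smI smJ G; have [f fP] := smI (fun i => G (inl i)).
have [g gP] := smJ (fun j => G (inr j)).
exists (fun n => maxn (f n) (g n)) => -[i|j]; apply/le_starP.
  have /le_starP[k kP] := fP i; exists k => n /kP fn.
  exact: leq_trans fn (leq_maxl _ _).
have /le_starP[k kP] := gP j; exists k => n /kP gn.
exact: leq_trans gn (leq_maxr _ _).
Qed.

Lemma eventually_on_finite_bigcap (T : eqType) (B : set {fset nat}) N
    (S : set T) (P : T -> set {fset nat}) :
  finite_set S -> (forall c, S c -> eventually_on B N (P c)) ->
  eventually_on B N (\bigcap_(c in S) P c).
Proof.
move=> /finite_seqP[r ->]; elim: r => [|c r IH] Pr.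
  by exists 0%N => s _ c /=; rewrite in_nil.
have Pc : eventually_on B N (P c) by apply: Pr; rewrite /= mem_head.
have /IH Prr d : [set` r] d -> eventually_on B N (P d).
  by move=> dr; apply: Pr; rewrite /= in_cons; apply/orP; right.
apply: eventually_onS (eventually_onI Pc Prr) => // s [sc sr] d /=.
by rewrite in_cons => /orP[/eqP->|/sr].
Qed.

Lemma eventually_on_notin_finite (T : eqType) (B : set {fset nat}) N
    (f : {fset nat} -> T) (S : set T) :
  (forall c, eventually_on B N [set s | f s <> c]) -> finite_set S ->
  eventually_on B N [set s | ~ S (f s)].
Proof.
move=> fN finS; have [k kP] := eventually_on_finite_bigcap finS (fun c _ => fN c).
by exists k => s /kP sS /sS.
Qed.

Lemma almost_disjoint_family (B C : set {fset nat}) :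
  b_eq_c -> barrier [set: nat] B -> barrier [set: nat] C ->
  C <> [set fset0] -> finite_set [set n | section C n = [set fset0]] ->
  (forall f : {fset nat} -> {fset nat}, (forall s, B s -> C (f s)) ->
    exists D N, [/\ FIN [set: nat] C D, infinite_set N &
      restr B N `<=` f @^-1` D]) ->
  exists AA : set (set {fset nat}),
  [/\ forall A, AA A -> FIN [set: nat] C A,
      forall A A', AA A -> AA A' -> A <> A' -> finite_set (A `&` A'),
      forall N, infinite_set N -> exists2 A, AA A &
        forall n, exists2 s, A s & restr C (tail N n) s &
      forall f : {fset nat} -> {fset nat}, (forall s, B s -> C (f s)) ->
        exists2 N, infinite_set N &
          (exists c, restr B N `<=` [set s | f s = c]) \/
          (forall c, eventually_on B N [set s | f s <> c]) /\
          ((exists2 A, AA A & restr B N `<=` f @^-1` A) \/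
           (forall A, AA A -> eventually_on B N [set s | ~ A (f s)]))].
Proof.
move=> bc MB MC C0 C1 BC; have [e einj] := task_injection.
have [J [R [wfR Rtot Rsm [task taskP]]]] := small_well_order (id, setT) bc einj.
(* Stage j yields A_j, a member of the family, and D_j in FIN^C, from which later members are kept
   almost disjoint. *)
pose V := (set {fset nat} * set {fset nat})%type.
pose good j (h : J -> V) (D : set {fset nat}) :=
  (forall s, B s -> C ((task j).1 s)) -> exists2 N, infinite_set N &
    (exists c, restr B N `<=` [set s | (task j).1 s = c]) \/
    (forall c, eventually_on B N [set s | (task j).1 s <> c]) /\
    ((exists2 i, R i j & restr B N `<=` (task j).1 @^-1` (h i).1) \/
     (restr B N `<=` (task j).1 @^-1` D /\
      forall i, R i j -> eventually_on B N [set s | ~ (h i).1 ((task j).1 s)])).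
(* A_j has to be almost disjoint from its own D_j too, since [good] speaks of earlier members
   only. *)
pose P j (h : J -> V) (v : V) :=
  [/\ FIN [set: nat] C v.1, FIN [set: nat] C v.2,
      finite_set (v.1 `&` v.2) /\ (forall i, R i j ->
        finite_set (v.1 `&` (h i).1) /\ finite_set (v.1 `&` (h i).2)),
      infinite_set (task j).2 ->
        forall n, exists2 s, v.1 s & restr C (tail (task j).2 n) s &
      good j h v.2].
have [h hP] : exists h, forall j, P j h (h j).
  apply: (transfinite_choice (set0, set0) wfR) => [j h h' v hh'|j h IH].
    move=> [v1 v2 [v12 vh] vN vf]; split=> //.
      by split=> // i Rij; rewrite -hh'//; exact: vh.
    move=> /vf[N Ninf [cN|[fN [[i Rij iN]|[DN hN]]]]]; exists N => //.
    - by left.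
    - by right; split=> //; left; exists i => //; rewrite -hh'.
    - right; split=> //; right; split=> // i Rij; rewrite -hh'//; exact: hN.
  set f := (task j).1.
  pose I := {i | R i j}.
  have smI : small I by exact: Rsm.
  have AD (i k : I) : i <> k -> finite_set ((h (sval i)).1 `&` (h (sval k)).1).
    move=> ik; have {ik} : sval i <> sval k.
      move=> eik; apply: ik; case: i k eik => [i Ri] [k Rk] /= eik.
      exact: eq_exist.
    move=> /Rtot[Rik|Rki].
      have [_ _ [_ /(_ _ Rik)[+ _]] _ _] := IH _ (svalP k).
      by rewrite setIC.
    by have [_ _ [_ /(_ _ Rki)[+ _]] _ _] := IH _ (svalP i).
  have [D FD Dgood] : exists2 D, FIN [set: nat] C D & good j h D.
    have [fBC|nf] := pselect (forall s, B s -> C (f s)); last first.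
      by exists set0; [exact: FIN_set0|move=> /nf].
    have [D [N0 [FD N0inf N0D]]] := BC f fBC; exists D => // _.
    have [//|N1 [N1inf N10 [cN1|fN1]]] :=
      constant_or_finite_to_one f MB N0inf _.
      by exists N1 => //; left.
    (* The isolated point d is seen through the earlier A_i containing it; [Y] adds the point at
       infinity and the points of the A_i. *)
    pose ev d : I -> Prop := fun i => (h (sval i)).1 d.
    pose Y : set (I -> Prop) := [set y | [\/ y = (fun=> False),
      exists i, y = (fun k => k = i) | exists d, y = ev d]].
    have Ycpt : pointwise_seq_compact Y.
      apply: almost_disjoint_seq_compact => [|i|i k ik].
      - by constructor 1.
      - by constructor 2; exists i.
      apply: sub_finite_set (finite_image ev (AD i k ik)).
      move=> y [[->//|[l ->] il kl|[d ->] di dk]]; last by exists d.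
      by case: ik; rewrite il kl.
    have [||N2 [N2inf N21 [y _ yP]]] :=
      barrier_pointwise_cvg smI Ycpt MB (f := ev \o f) _ N1inf _.
    - by move=> s; constructor 3; exists (f s).
    - by [].
    (* A limit with a true coordinate i puts f into A_i on a tail; a limit without one is infinity,
       and f is eventually off each earlier A_i. *)
    have [[i yi]|ny] := pselect (exists i, y i).
      have [k kP] := yP i; exists (tail N2 k); first exact: infinite_tail.
      right; split.
        move=> c; apply: eventually_onS (fN1 c) => //.
        exact: (subset_trans (@tail_sub _ _) N21).
      left; exists (sval i); first exact: (proj2_sig i).
      by move=> s /kP /= sy; apply/sy.
    exists N2 => //; right; split=> [c|].
      exact: eventually_onS (fN1 c).
    right; split=> [s sN2|i Rij].
      by apply: N0D; apply: restrS sN2; exact: subset_trans N21 N10.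
    apply: eventually_onS (yP (exist _ i Rij)) => // s /= sy si; apply: ny.
    by exists (exist _ i Rij); apply/sy.
  (* A finite set in the task demands nothing and is replaced by [setT]. *)
  have [N [Ninf NP]] : exists N, infinite_set N /\
      (infinite_set (task j).2 -> N = (task j).2).
    have [Ninf|nN] := pselect (infinite_set (task j).2).
      by exists (task j).2.
    by exists setT; split=> //; exact: infinite_nat.
  pose DD (i : I + I + unit) := match i with
    | inl (inl i) => (h (sval i)).1
    | inl (inr i) => (h (sval i)).2
    | inr _ => D
    end.
  have smII : small (I + I + unit).
    by apply: small_sum; [exact: small_sum|exact: small_unit].
  have [|//|A [FA AD' AN]] := FIN_transversal (D := DD) smII MC C0 C1 _ Ninf _.
    by move=> [[i|i]|[]] //=; have [] := IH _ (svalP i).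
  exists (A, D); split=> //=; last by move=> /NP <-.
  split=> [|i Rij]; first exact: AD' (inr tt).
  split; first exact: AD' (inl (inl (exist _ i Rij))).
  exact: AD' (inl (inr (exist _ i Rij))).
exists (range (fst \o h)); split.
- by move=> _ [j _ <-]; have [] := hP j.
- move=> _ _ [i _ <-] [j _ <-] hij.
  have : i <> j by move=> ij; apply: hij; rewrite ij.
  move=> /Rtot[Rij|Rji].
    have [_ _ [_ /(_ _ Rij)[+ _]] _ _] := hP j.
    by rewrite setIC.
  by have [_ _ [_ /(_ _ Rji)[+ _]] _ _] := hP i.
- move=> N Ninf; have [j jN] := taskP (id, N).
  exists (h j).1; first by exists j.
  by have [_ _ _ + _] := hP j; rewrite jN; apply.
- move=> f fBC; have [j jf] := taskP (f, setT).
  have [_ _ [hjj _] _ ] := hP j; rewrite /good jf /=.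
  move=> /(_ fBC)[N Ninf [cN|[fN fN']]]; exists N => //; first by left.
  right; split=> //; case: fN' => [[i Rij iN]|[DN hN]].
    by left; exists (h i).1 => //; exists i.
  right=> _ [i _ <-] /=.
  (* Stages before [j] are covered by [good]. Any other A_i meets D_j in a finite set, which f
     eventually leaves while staying in D_j. *)
  have [Rij|nRij] := pselect (R i j); first exact: hN.
  have fin : finite_set ((h i).1 `&` (h j).2).
    have [->//|ij] := pselect (i = j).
    have [//|Rji] := Rtot i j ij.
    by have [_ _ [_ /(_ _ Rji)[_ +]] _ _] := hP i.
  have [k kP] := eventually_on_notin_finite fN fin; exists k => s sk /= si.
  apply: (kP s sk); split=> //; apply: DN.
  by apply: restrS sk; exact: tail_sub.
Qed.

(** * The space *)

(** The Mrowka-Isbell space of [AA] with a point at infinity: [inl] gives the isolated points, [inr]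
    the points p_A, [None] infinity. *)
Definition psi_space (T : Type) (AA : set (set T)) : Type := option (T + set T).

Section psi_space.
Variables (T : Type) (AA : set (set T)).

HB.instance Definition _ := gen_eqMixin (psi_space AA).
HB.instance Definition _ := gen_choiceMixin (psi_space AA).

Definition psi_point (d : T) : psi_space AA := Some (inl d).
Definition psi_set (A : set T) : psi_space AA := Some (inr A).
Definition psi_infty : psi_space AA := None.

(* The points psi_set A for A outside AA are isolated; they are kept in order to
   avoid a subtype, and converge to psi_infty like all others. *)
Definition psi_open (U : set (psi_space AA)) : Prop :=
  (forall A, AA A -> U (psi_set A) ->
     finite_set [set d | A d /\ ~ U (psi_point d)]) /\
  (U psi_infty -> exists F : set (set T),
    [/\ finite_set F, forall A, ~ F A -> U (psi_set A) &
      finite_set [set d | ~ U (psi_point d) /\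
                          forall A, F A -> AA A -> ~ A d]]).

Lemma psi_openT : psi_open setT.
Proof.
split=> [A _ _|_].
  by apply: (@sub_finite_set _ _ set0) => // d [_ []].
exists set0; split=> //; apply: (@sub_finite_set _ _ set0) => // d [[]] //.
Qed.

Lemma psi_openI : setI_closed psi_open.
Proof.
move=> U V [UA Uoo] [VA Voo]; split=> [A AAA [UAA VAA]|].
  apply: (@sub_finite_set _ _ ([set d | A d /\ ~ U (psi_point d)] `|`
                               [set d | A d /\ ~ V (psi_point d)])).
    by move=> d [Ad /not_andP[nU|nV]]; [left|right].
  by rewrite finite_setU; split; [exact: UA|exact: VA].
move=> [/Uoo[F [Ff FU Ufin]] /Voo[G [Gf GV Vfin]]].
exists (F `|` G); split; first by rewrite finite_setU.
  by move=> A /not_orP[nF nG]; split; [exact: FU|exact: GV].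
apply: (@sub_finite_set _ _ _ _ (_ : finite_set (_ `|` _))); last first.
  by rewrite finite_setU; split; [exact: Ufin|exact: Vfin].
move=> d [/not_andP[nU|nV] FG]; [left|right]; split=> // A AF.
  by apply: FG; left.
by apply: FG; right.
Qed.

Lemma psi_open_bigU (I : Type) (f : I -> set (psi_space AA)) :
  (forall i, psi_open (f i)) -> psi_open (\bigcup_i f i).
Proof.
move=> fo; split=> [A AAA [i _ iA]|[i _ /(fo i).2[F [Ff FU Ufin]]]].
  apply: sub_finite_set ((fo i).1 A AAA iA) => d [Ad nd]; split=> // fd.
  by apply: nd; exists i.
exists F; split=> // [A /FU FA|]; first by exists i.
apply: sub_finite_set Ufin => d [nd dF]; split=> // fd.
by apply: nd; exists i.
Qed.

HB.instance Definition _ := isOpenTopological.Build (psi_space AA)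
  psi_openT psi_openI psi_open_bigU.

Lemma open_psi_point d : open [set psi_point d].
Proof. by split. Qed.

(** A basic neighbourhood of p_A, which shrinks to a single point for [A] outside [AA]. *)
Lemma open_psi_set A :
  open [set x | x = psi_set A \/ exists d, [/\ AA A, A d & x = psi_point d]].
Proof.
split=> [A' AA' [[A'A]|[d [_ _ ?//]]]|[//|[d [_ _ //]]]].
apply: (@sub_finite_set _ _ set0) => // d [A'd]; apply; right.
by exists d; split=> //; rewrite -A'A.
Qed.

(** This separates infinity from [A]. Openness at another p_A' is almost disjointness; at infinity
    the exceptional family is {A}. *)
Lemma open_psi_setC A : AA A ->
  (forall A', AA A' -> A' <> A -> finite_set (A' `&` A)) ->
  open [set x | x <> psi_set A /\ forall d, A d -> x <> psi_point d].
Proof.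
move=> AAA ad; split=> [A' AA' [A'A _]|_].
  apply: (@sub_finite_set _ _ (A' `&` A)).
    move=> d [A'd nd]; split=> //; apply: contrapT => nAd; apply: nd.
    by split=> // d' Ad' [dd']; apply: nAd; rewrite dd'.
  by apply: ad => // e; apply: A'A; rewrite e.
exists [set A]; split; first exact: finite_set1.
  by move=> A' A'A; split=> // -[e]; apply: A'A.
apply: (@sub_finite_set _ _ set0) => // d [nd /(_ A erefl AAA) nAd]; apply: nd.
by split=> // d' Ad' [dd']; apply: nAd; rewrite dd'.
Qed.

End psi_space.

Lemma barrier_cvgP (X : topologicalType) M B (f : {fset nat} -> X) x :
  barrier_cvg M (restr B M) f x <->
  forall U, open U -> U x -> eventually_on B M (f @^-1` U).
Proof.
split=> cvg U Uo /(cvg U Uo)[n nU]; exists n.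
  move=> s [Bs sM]; apply: nU; exists s => //; split=> //.
  by split=> //; exact: subset_trans sM (@tail_sub _ _).
by move=> _ [s [[Bs _] sM] <-]; exact: nU.
Qed.

Lemma barrier_restr_neq0 M B N :
  barrier M B -> infinite_set N -> N `<=` M -> exists s, restr B N s.
Proof.
by move=> [_ _ _ Bin] Ninf /Bin -/(_ Ninf)[s Bs [sN _]]; exists s.
Qed.

Lemma barrier_late M B N k :
  barrier M B -> B <> [set fset0] -> infinite_set N -> N `<=` M ->
  exists s m, [/\ restr B N s, m \in s & (k <= m)%N].
Proof.
move=> MB B0 Ninf NM; have [||s [Bs sN]] := @barrier_restr_neq0 M B (tail N k) MB.
- exact: infinite_tail.
- exact: (subset_trans (@tail_sub _ _) NM).
have [m [t [st _ _]]] := barrier_neq0 MB B0 Bs.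
have ms : m \in s by rewrite st fset1U1.
exists s, m; split=> //; last by have [] := sN m ms.
by split=> // l /sN[].
Qed.

Lemma barrier_not_constant M B N c :
  barrier M B -> B <> [set fset0] -> infinite_set N -> N `<=` M ->
  exists s, restr B N s /\ s <> c.
Proof.
move=> MB B0 Ninf NM; have [k kc] := finite_nat_late (finite_fset c).
have [s [m [Bs ms km]]] := barrier_late k MB B0 Ninf NM.
by exists s; split=> // sc; apply: (kc m km); rewrite -sc.
Qed.

Lemma FIN_sub M B X : FIN M B X -> X `<=` B.
Proof. by case=> // {}M s. Qed.

(** This excludes C = {emptyset}: its ideal has only the empty set, so a constant map is a
    reduction. *)
Lemma katetov_le_trivial (B C : set {fset nat}) M :
  barrier [set: nat] B -> C = [set fset0] -> katetov_le C (FIN M C) B (Gc B).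
Proof.
move=> MB ->; exists (fun=> fset0) => // A /FIN_trivialE ->.
rewrite preimage_set0 setI0; split=> // -[X Xinf XB].
by have [//|s /XB] := barrier_restr_neq0 MB Xinf _.
Qed.

(* If infinitely many singletons {n} belong to C, then mapping s to one of them
   with n beyond s is a Katetov reduction. *)
Lemma katetov_le_singletons (B C : set {fset nat}) :
  barrier [set: nat] B -> B <> [set fset0] -> C <> [set fset0] ->
  infinite_set [set n | section C n = [set fset0]] ->
  katetov_le C (FIN [set: nat] C) B (Gc B).
Proof.
move=> MB B0 C0 /infinite_natP C1.
have /choice[n nP] : forall s : {fset nat}, exists n,
    section C n = [set fset0] /\ forall m, m \in s -> (m <= n)%N.
  move=> s; have [k ks] := finite_nat_late (finite_fset s).
  have [n nC kn] := C1 k; exists n; split=> // m ms.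
  rewrite leqNgt; apply/negP => nm; apply: (ks m) => //.
  exact: leq_trans kn (ltnW nm).
exists (fun s => [fset n s]%fset) => [s _ /=|A].
  have [nC _] := nP s; have : section C (n s) fset0 by rewrite nC.
  by move=> /sectionP[_]; rewrite fsetU0.
move=> /(FIN_recE _ _ C0)[_ /finite_nat_late[k kP]].
split=> [s []//|[X Xinf XA]].
have [//|s [m [Bs ms km]]] := barrier_late k MB B0 Xinf _.
have [_ /= As] := XA s Bs; have [nC /(_ m ms) mn] := nP s.
apply: (kP (n s) (leq_trans km mn)); split=> //.
rewrite nC => /FIN_trivialE A0.
have : section A (n s) fset0 by apply/sectionP; rewrite fsetU0.
by rewrite A0.
Qed.

(** This serves the case B = {emptyset}. An injective map is not constant on any C|N, so it cannot
    converge in a discrete space. *)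
Lemma discrete_not_seq_compact C : barrier [set: nat] C -> C <> [set fset0] ->
  ~ seq_compact C nat.
Proof.
move=> MC C0 Ccpt; have [code code_inj] := fset_nat_countable.
have [M Minf [x /barrier_cvgP/(_ [set x])[||n nx]]] := Ccpt code.
- exact: discrete_open.
- by [].
have [//|s sn] := barrier_restr_neq0 MC (infinite_tail (k := n) Minf) _.
have [//|t [/nx tx] []] :=
  barrier_not_constant s MC C0 (infinite_tail (k := n) Minf) _.
by apply: code_inj; rewrite tx; apply/esym; exact: nx.
Qed.

Section psi_space_of_barriers.
Variables (B C : set {fset nat}) (AA : set (set {fset nat})).
Hypotheses (MB : barrier [set: nat] B) (MC : barrier [set: nat] C).
Hypotheses (C0 : C <> [set fset0]).
Hypothesis AAF : forall A, AA A -> FIN [set: nat] C A.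
Hypothesis AAd : forall A A', AA A -> AA A' -> A <> A' -> finite_set (A `&` A').

Lemma psi_seq_compact :
  (forall f : {fset nat} -> {fset nat}, (forall s, B s -> C (f s)) ->
    exists2 N, infinite_set N &
      (exists c, restr B N `<=` [set s | f s = c]) \/
      (forall c, eventually_on B N [set s | f s <> c]) /\
      ((exists2 A, AA A & restr B N `<=` f @^-1` A) \/
       (forall A, AA A -> eventually_on B N [set s | ~ A (f s)]))) ->
  seq_compact B (psi_space AA).
Proof.
move=> fP f.
have const_cvg N x : restr B N `<=` [set s | f s = x] ->
    barrier_cvg N (restr B N) f x.
  move=> Nx; apply/barrier_cvgP => U _ Ux; exists 0%N => s sN.
  by rewrite /preimage /= (Nx s (restrS (@tail_sub _ _) sN)).
have [c0 Cc0] : exists c0, C c0.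
  by have [//|s []] := barrier_restr_neq0 MC infinite_nat _; exists s.
have /choice[f' f'P] : forall s, exists d,
    C d /\ forall d', C d' -> f s = psi_point AA d' -> d = d'.
  move=> s.
  have [[d [Cd sd]]|ns] := pselect (exists d, C d /\ f s = psi_point AA d).
    by exists d; split=> // d' _; rewrite sd => -[].
  by exists c0; split=> // d' Cd' sd'; case: ns; exists d'.
have [N Ninf NP] := fP f' (fun s _ => (f'P s).1).
(* Either all values on a restriction are points of C, and the hypothesis on [f'] applies, or none
   is. *)
have [//|N1 [N1inf N1N [fC|fnC]]] :=
  nash_williams [set s | exists d, C d /\ f s = psi_point AA d] MB Ninf _.
  have fE s : restr B N1 s -> f s = psi_point AA (f' s).
    by move=> /fC[d [Cd sd]]; rewrite ((f'P s).2 d Cd sd).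
  exists N1 => //; case: NP => [[c Nc]|[Nc [[A AAA NA]|NA]]].
  - exists (psi_point AA c); apply: const_cvg => s sN1 /=.
    by rewrite fE// -(Nc s (restrS N1N sN1)).
  - exists (psi_set AA A); apply/barrier_cvgP => U [UA _] /(UA A AAA) fin.
    have [k kP] := eventually_on_notin_finite Nc fin; exists k => s sN1.
    rewrite /preimage /= fE; last by apply: restrS sN1; exact: tail_sub.
    apply: contrapT => nU; apply: (kP s).
      by apply: restrS sN1; exact: tailS.
    split=> //; apply: NA; apply: restrS sN1.
    exact: (subset_trans (@tail_sub _ _) N1N).
  - exists (psi_infty AA); apply/barrier_cvgP => U [_ Uoo] /Uoo[F [Ff _ fin]].
    have [k kP] := eventually_on_notin_finite Nc fin.
    have [l lP] : eventually_on B N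
        (\bigcap_(A in F) [set s | AA A -> ~ A (f' s)]).
      apply: eventually_on_finite_bigcap => // A FA.
      have [AAA|nA] := pselect (AA A); last by exists 0%N => s _ /nA.
      by have [m mP] := NA A AAA; exists m => s /mP sA _.
    exists (maxn k l) => s sN1; rewrite /preimage /= fE; last first.
      by apply: restrS sN1; exact: tail_sub.
    apply: contrapT => nU; apply: (kP s).
      by apply: restrS sN1; apply: tailS => //; exact: leq_maxl.
    split=> // A FA; apply: lP => //.
    by apply: restrS sN1; apply: tailS => //; exact: leq_maxr.
(* A neighbourhood of infinity omits only finitely many points apart from elements of sets in [AA].
   These sets lie in C, where f has no values now, so f tends to infinity unless it is constant. *)
have [//|N2 [N2inf N21 [[c Nc]|Nc]]] := constant_or_finite_to_one f MB N1inf _.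
  by exists N2 => //; exists c; exact: const_cvg.
exists N2 => //; exists (psi_infty AA); apply/barrier_cvgP => U [_ Uoo] Uinf.
have [F [Ff FU fin]] := Uoo Uinf.
have finS : finite_set (psi_set AA @` F `|`
    psi_point AA @` [set d | ~ U (psi_point AA d) /\
                             forall A, F A -> AA A -> ~ A d]).
  by rewrite finite_setU; split; exact: finite_image.
have [k kP] := eventually_on_notin_finite Nc finS; exists k => s sN2.
apply: contrapT; rewrite /preimage /= => nU; apply: (kP s sN2).
have sN1 : restr B N1 s.
  by apply: restrS sN2; exact: (subset_trans (@tail_sub _ _) N21).
case fs : (f s) nU => [[d|A]|] nU //.
- right; exists d => //; split=> // A FA AAA Ad; apply: (fnC s sN1).
  by exists d; split=> //; exact: FIN_sub (AAF AAA) _ Ad.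
- by left; exists A => //; apply: contrapT => /FU.
Qed.

Lemma psi_not_seq_compact :
  (forall N, infinite_set N -> exists2 A, AA A &
     forall n, exists2 s, A s & restr C (tail N n) s) ->
  ~ seq_compact C (psi_space AA).
Proof.
move=> AAN Ccpt; have [M Minf [x /barrier_cvgP cvg]] := Ccpt (psi_point AA).
case: x cvg => [[c|A]|] cvg.
- have [//|n nP] := cvg _ (open_psi_point AA c) _.
  by have [//|s [/nP[]]] :=
    barrier_not_constant c MC C0 (infinite_tail (k := n) Minf) _.
- have [|n nP] := cvg _ (open_psi_set AA A) _; first by left.
  (* For [A] outside [AA] the neighbourhood contains no isolated point of the form [psi_point d], so
     any s at all gives [AA A]. *)
  have nA s : restr C (tail M n) s -> AA A /\ A s.
    by move=> /nP[//|[d [? ? [->]]]].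
  have [//|s0 /nA[AAA _]] :=
    barrier_restr_neq0 MC (infinite_tail (k := n) Minf) _.
  have [//|N [Ninf NM /(_ tt)[k kP]]] := FIN_small_avoid (D := fun=> A)
    small_unit MC (fun=> AAF AAA) (infinite_tail (k := n) Minf) _.
  have [//|s sN] := barrier_restr_neq0 MC (infinite_tail (k := k) Ninf) _.
  apply: (kP s sN); have [] // := nA s.
  by apply: restrS sN; exact: (subset_trans (@tail_sub _ _) NM).
- have [A AAA AM] := AAN M Minf.
  have [||n nP] := cvg _ (@open_psi_setC _ AA A AAA _) _.
  + by move=> A' AA' A'A; exact: AAd.
  + by [].
  have [s As /nP[_ /(_ s As)]] := AM n.
  by [].
Qed.

End psi_space_of_barriers.

Theorem theorem5p13 (hbc : b_eq_c) (B C : set {fset nat})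
    (hB : barrier [set: nat] B) (hC : barrier [set: nat] C)
    (hBC : ~ katetov_le C (FIN [set: nat] C) B (Gc B)) :
  exists X : topologicalType, seq_compact B X /\ ~ seq_compact C X.
Proof.
have C0 : C <> [set fset0] by move=> /(katetov_le_trivial [set: nat] hB).
(* For B = {emptyset} a map has a single value on B and converges in every space. *)
have [B0|B0] := pselect (B = [set fset0]).
  exists nat; split; last exact: discrete_not_seq_compact.
  move=> f; exists setT; first exact: infinite_nat.
  exists (f fset0); apply/barrier_cvgP => U _ Uf; exists 0%N => s [+ _].
  by rewrite B0 => ->.
have C1 : finite_set [set n | section C n = [set fset0]].
  apply: contrapT => C1; exact/hBC/katetov_le_singletons.
have [f fBC|AA [AAF AAd AAN AAB]] := almost_disjoint_family hbc hB hC C0 C1.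
  (* A map for which no such D and N exist would be a Katetov reduction. *)
  apply: contrapT => nD; apply: hBC; exists f => // A FA; split=> [s []//|].
  move=> [X Xinf XA]; apply: nD; exists A, X; split=> // s /XA[].
  by [].
exists (psi_space AA); split; first exact: psi_seq_compact AAF AAB.
exact: psi_not_seq_compact AAN.
Qed.
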